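(* Let $G$ be a finite simple undirected graph of order $N$ (i.e. with $N\ge 1$ vertices). Suppose $G$ has exactly $c$ connected components, $r$ of which are isolated vertices (so exactly $r$ vertices of $G$ are isolated, each counted among the $c$ components). Then $$NEE(G)\ \ge\ (N-c)\,e^{\frac{c-r}{N-c}}+c\,e^{-1},$$ where the term $(N-c)e^{\frac{c-r}{N-c}}$ is read as $0$ if $N=c$. Moreover, equality holds if and only if $G$ is a disjoint union of copies of the complete graph $K_s$, for some fixed integer $s\ge 2$, and $r$ isolated vertices (the number of copies of $K_s$ being $c-r$, which may be zero).
   Context: For a finite simple undirected graph $G$ with vertices $v_1,\dots,v_N$, let $A$ be its adjacency matrix, $D$ the diagonal matrix whose $i$-th diagonal entry is the degree $d_i$ of $v_i$, and $L=D-A$. The normalized Laplacian matrix is $\mathcal{L}=\mathcal{L}(G)=D^{-1/2}LD^{-1/2}$, with the convention $d_i^{-1}=0$ (and likewise $d_i^{-1/2}=0$) if $d_i=0$. Its eigenvalues, listed with multiplicity as $\lambda_1\ge\lambda_2\ge\cdots\ge\lambda_N$, are the normalized Laplacian eigenvalues of $G$. The normalized Laplacian Estrada index of $G$ is $$NEE(G)=\sum_{i=1}^N e^{\lambda_i-1}.$$ *)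

(* Defs.v *)
From HB Require Import structures.
From mathcomp Require Import all_boot all_order all_algebra.
From mathcomp Require Import reals sequences exp.
From mathcomp Require Import polyrcf.
Set Implicit Arguments.
Unset Strict Implicit.
Unset Printing Implicit Defensive.
Import Order.TTheory GRing.Theory Num.Theory.
Local Open Scope ring_scope.

(* A finite simple graph is a symmetric and irreflexive relation e on a finType
   of vertices; symmetry and irreflexivity are hypotheses of the statements.
   Matrices are indexed through the enumeration enum_val of the vertices. *)

Definition degree (T : finType) (e : rel T) (x : T) : nat := #|[set y | e x y]|.

Definition isolated_vertices (T : finType) (e : rel T) : {set T} :=
  [set x | [forall y, ~~ e x y]].

Definition adjacency_mx (R : realType) (T : finType) (e : rel T) : 'M[R]_#|T| :=
  \matrix_(i, j) (e (enum_val i) (enum_val j))%:R.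

Definition degree_mx (R : realType) (T : finType) (e : rel T) : 'M[R]_#|T| :=
  diag_mx (\row_i (degree e (enum_val i))%:R).

Definition laplacian_mx (R : realType) (T : finType) (e : rel T) : 'M[R]_#|T| :=
  degree_mx R e - adjacency_mx R e.

(* D^(-1/2); since 0^-1 = 0, the entries of isolated vertices are 0. *)
Definition degree_invsqrt_mx (R : realType) (T : finType) (e : rel T) :
    'M[R]_#|T| :=
  diag_mx (\row_i (Num.sqrt (degree e (enum_val i))%:R)^-1).

Definition normalized_laplacian_mx (R : realType) (T : finType) (e : rel T) :
    'M[R]_#|T| :=
  degree_invsqrt_mx R e *m laplacian_mx R e *m degree_invsqrt_mx R e.

(* The real eigenvalues of A in nonincreasing order, each repeated according to
   its algebraic multiplicity. For a symmetric A all the eigenvalues are real,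
   and the list has n elements. *)
Definition spectrum (R : realType) (n : nat) (A : 'M[R]_n) : seq R :=
  flatten [seq nseq (mup x (char_poly A)) x | x <- rev (rootsR (char_poly A))].

Definition NEE (R : realType) (T : finType) (e : rel T) : R :=
  \sum_(x <- spectrum (normalized_laplacian_mx R e)) expR (x - 1).

Definition complete_graph (s : nat) : rel 'I_s := fun i j => i != j.

Definition empty_graph (r : nat) : rel 'I_r := fun _ _ => false.

Definition copies (k : nat) (T : finType) (e : rel T) : rel ('I_k * T) :=
  fun u v => (u.1 == v.1) && e u.2 v.2.

Definition disjoint_union (T1 T2 : finType) (e1 : rel T1) (e2 : rel T2) :
    rel (T1 + T2) :=
  fun u v => match u, v with
             | inl x, inl y => e1 x y
             | inr x, inr y => e2 x y
             | _, _ => false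
             end.

Definition graph_isomorphic (T1 T2 : finType) (e1 : rel T1) (e2 : rel T2) :
    Prop :=
  exists2 f : T1 -> T2, bijective f & {mono f : x y / e1 x y >-> e2 x y}.

(* Main.v *)
Require Import Defs.
From HB Require Import structures.
From mathcomp Require Import all_boot all_order all_algebra.
From mathcomp Require Import reals sequences exp.
From mathcomp Require Import polyrcf complex ring.
Set Implicit Arguments.
Unset Strict Implicit.
Unset Printing Implicit Defensive.
Import Order.TTheory GRing.Theory Num.Theory.
Local Open Scope ring_scope.

(** Write [L] for the normalized Laplacian, [N] for the number of vertices, [c]
    for the number of components and [r] for the number of isolated vertices.

    Being symmetric, [L] is diagonalizable over the reals, so that the Estrada
    index is the sum of [expR (d_i - 1)] over a diagonal form [d] of [L].  Two
    numbers about [d] are known without computing any eigenvalue.  The rank of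
    [L] is [N - c]: up to multiplication by invertible diagonal matrices [L] is
    the Laplacian [D - A], whose kernel consists of the vectors constant on the
    components, because its quadratic form is a sum of squares over the edges
    ([dirichlet_form]).  The trace of [L] is [N - r], since every non-isolated
    vertex contributes 1.  Hence [c] of the [d_i] vanish, and the [N - c] others
    satisfy: [d_i - 1] has mean [(c - r) / (N - c)].  The bound is Jensen's
    inequality for the exponential over the nonzero [d_i].

    Equality in Jensen's inequality means that the nonzero eigenvalues coincide,
    which for a diagonalizable matrix says that [L *m L = l *: L] for some [l].
    This identity can be read on the entries.  If [x] and [z] are distinct,
    nonadjacent and have a common neighbour, the [(x, z)] entry of [L *m L] is a
    sum of nonnegative terms, one of them positive, while that of [L] is 0; so
    adjacency is transitive and the components are cliques.  In a clique the
    diagonal entry then gives [l = 1 + 1 / degree], so all nontrivial cliques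
    have the same size.  Conversely a union of cliques of size [s] satisfies the
    identity with [l = s / (s - 1)].  The predicate [equal_cliques] expresses
    this shape inside the given graph, and is translated at the end into an
    isomorphism with copies of [K_s] and isolated vertices. *)

(** * Diagonalization of real symmetric matrices *)

Lemma realmx_of_complex (R : rcfType) m n (A : 'M[R[i]]_(m, n)) :
  A \is a mxOver Num.real -> exists B : 'M[R]_(m, n), A = map_mx (real_complex R) B.
Proof.
move=> /mxOverP Areal; exists (map_mx (@complex.Re R) A).
by apply/matrixP => i j; rewrite !mxE RRe_real ?Areal.
Qed.

(** The spectral theorem over [R[i]] yields a real diagonal form and a complex
    change of basis; [real_similar] replaces the latter by a real one. *)
Lemma symmetric_diagonalizable (R : rcfType) n (A : 'M[R]_n) : A^T = A ->
  exists P d, P \in unitmx /\ P *m A = diag_mx d *m P.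
Proof.
move=> Asym; pose AC := map_mx (real_complex R) A.
have ofR_real m p (B : 'M[R]_(m, p)) : map_mx (real_complex R) B \is a mxOver Num.real.
  by apply/mxOverP => i j; rewrite mxE; apply/complex_realP; exists (B i j).
have AC_herm : AC \is hermsymmx.
  apply: realsym_hermsym; last exact: ofR_real.
  apply/is_hermitianmxP; apply/matrixP => i j.
  by rewrite expr0 scale1r !mxE -[in LHS]Asym mxE.
have [D D_eq] := realmx_of_complex (hermitian_spectral_diag_real AC_herm).
have AC_sim : exists2 P, P \in unitmx & simmx_for P AC (diag_mx (spectral_diag AC)).
  exists (spectralmx AC); first exact: spectral_unit.
  apply/simmxP; first exact: spectral_unit.
  have /hermitian_normalmx/orthomx_spectralP E := AC_herm.
  by rewrite [X in _ *m X = _]E !mulmxA mulmxV ?spectral_unit // mul1mx.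
have [||Q /andP[Qreal Qunit] /(simmxP Qunit)] := real_similar AC_sim.
- exact: ofR_real.
- by rewrite D_eq -map_diag_mx ofR_real.
have [P P_eq] := realmx_of_complex Qreal; move: Qunit; rewrite P_eq map_unitmx.
move=> Punit; rewrite /AC D_eq -map_diag_mx -!map_mxM => /(map_mx_inj) PA.
by exists P, D.
Qed.

Lemma rank_diag_mx (F : fieldType) n (d : 'rV[F]_n) :
  \rank (diag_mx d) = (\sum_(i < n) (d 0%R i != 0%R))%N.
Proof.
elim: n d => [|n IHn] d; first by rewrite big_ord0 flatmx0 mxrank0.
pose l : 'rV[F]_1 := @lsubmx F 1 1 n d; pose r : 'rV[F]_n := @rsubmx F 1 1 n d.
have -> : \rank (diag_mx d) = (\rank (diag_mx l) + \rank (diag_mx r))%N.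
  by rewrite -rank_diag_block_mx -diag_mx_row hsubmxK.
rewrite IHn big_ord_recl; congr (_ + _)%N.
  rewrite rank_rV; congr (nat_of_bool (~~ _)); apply/eqP/eqP => [/matrixP/(_ 0 0)|d0].
    by rewrite !mxE eqxx; congr (d _ _ = _); apply: val_inj.
  apply/matrixP => i j; rewrite !ord1 !mxE eqxx -[RHS]d0.
  by congr (d _ _); apply: val_inj.
by apply: eq_bigr => i _; rewrite mxE; congr (d _ _ != 0); apply: val_inj.
Qed.

Section Diagonalized.
Variables (R : realType) (n : nat) (A P : 'M[R]_n) (d : 'rV[R]_n).
Hypotheses (Punit : P \in unitmx) (PA : P *m A = diag_mx d *m P).

Let AE : A = invmx P *m diag_mx d *m P.
Proof. by rewrite -mulmxA -PA mulKmx. Qed.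

(** Similar matrices have the same characteristic polynomial, and that of
    [diag_mx d] splits with the entries of [d] as roots; both lists therefore
    count every root as often as its multiplicity. *)
Lemma spectrum_diagonalized : perm_eq (spectrum A) [seq d 0 i | i : 'I_n].
Proof.
pose s := [seq d 0 i | i : 'I_n].
have char_polyE : char_poly A = \prod_(x <- s) ('X - x%:P).
  have -> : char_poly A = char_poly (diag_mx d).
    pose PX := map_mx polyC P.
    have PXu : PX \in unitmx.
      by rewrite unitmxE /PX det_map_mx rmorph_unit // -unitmxE.
    have E : PX *m char_poly_mx A = char_poly_mx (diag_mx d) *m PX.
      rewrite /char_poly_mx mulmxBr mulmxBl -!map_mxM PA.
      by rewrite mul_mx_scalar mul_scalar_mx.
    move/(congr1 determinant): E; rewrite !det_mulmx [LHS]mulrC.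
    by apply: mulIr; rewrite -unitmxE.
  rewrite char_poly_trig ?diag_mx_is_trig // big_image /=.
  by apply: eq_bigr => i _; rewrite mxE eqxx.
have char_poly_neq0 : char_poly A != 0 by rewrite monic_neq0 ?char_poly_monic.
have mem_rootsR x : (x \in rootsR (char_poly A)) = (x \in s).
  by rewrite -(roots_on_rootsR char_poly_neq0) /= char_polyE root_prod_XsubC.
apply/allP => x _ /=; apply/eqP.
have mupE y : mup y (char_poly A) = count_mem y s by rewrite char_polyE mu_prod_XsubC.
rewrite /spectrum count_flatten -map_comp sumnE big_map.
under eq_bigr do rewrite /= count_nseq mupE /=.
have [xs|xs] := boolP (x \in s); last first.
  rewrite (count_memPn xs) big_seq big1 // => y.
  rewrite mem_rev mem_rootsR; case: eqVneq => [->|//]; first by rewrite (negPf xs).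
have xr : x \in rev (rootsR (char_poly A)) by rewrite mem_rev mem_rootsR.
rewrite (bigD1_seq x) ?rev_uniq ?uniq_roots //= eqxx mul1n.
by rewrite big1 ?addn0 // => y /negPf->.
Qed.

Lemma mxtrace_diagonalized : \tr A = \sum_i d 0 i.
Proof. by rewrite AE -mulmxA mxtrace_mulC mulmxK // mxtrace_diag. Qed.

Lemma rank_diagonalized : (\rank A = \sum_(i < n) (d 0%R i != 0%R))%N.
Proof.
have -> : \rank A = \rank (diag_mx d).
  rewrite AE mxrankMfree ?row_free_unit // -mxrank_tr trmx_mul.
  by rewrite mxrankMfree ?mxrank_tr // row_free_unit unitmx_tr unitmx_inv.
by rewrite rank_diag_mx.
Qed.

(** The matrix identity tells that a diagonalizable matrix has at most one
    nonzero eigenvalue, in a form that can be tested on its entries. *)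
Lemma sqr_diagonalized l : A *m A = l *: A <-> forall i, d 0 i != 0 -> d 0 i = l.
Proof.
have -> : (A *m A = l *: A) <-> (diag_mx d *m diag_mx d = l *: diag_mx d).
  split=> E; last first.
    rewrite {1}AE -!mulmxA mulmxA PA; rewrite -!mulmxA (mulmxA (diag_mx d)) E.
    by rewrite AE -scalemxAl -scalemxAr mulmxA.
  apply: (can_inj (mulmxK Punit)).
  by rewrite -mulmxA -PA mulmxA -PA -mulmxA E -scalemxAl -PA scalemxAr.
rewrite mulmx_diag; split=> [/matrixP E i di|E].
  by apply: (mulIf di); have := E i i; rewrite !mxE eqxx.
apply/matrixP => i j; rewrite !mxE mulrnAr; congr (_ *+ _).
by have [->|/E ->//] := eqVneq (d 0 i) 0; rewrite !mulr0.
Qed.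
End Diagonalized.

(** * Rank and trace of the normalized Laplacian *)

Section GraphMatrices.
Variables (R : realType) (T : finType) (e : rel T).
Hypotheses (e_sym : symmetric e) (e_irr : irreflexive e).

Lemma degree_eq0 x : (degree e x == 0%N) = (x \in isolated_vertices e).
Proof.
rewrite inE /degree cards_eq0; apply/eqP/forallP => [E y|E].
  by have := in_set0 y; rewrite -E inE => ->.
by apply/setP => y; rewrite !inE (negPf (E y)).
Qed.

Lemma degree_gt0 x y : e x y -> (0 < degree e x)%N.
Proof. by move=> exy; apply/card_gt0P; exists y; rewrite inE. Qed.

Lemma degree_sum x : (degree e x)%:R = \sum_y (e x y)%:R :> R.
Proof.
rewrite -natr_sum; congr _%:R; rewrite /degree -sum1_card big_mkcond /=.
by apply: eq_bigr => y _; rewrite inE; case: (e x y).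
Qed.

Lemma sum_enum_val (F : T -> R) : \sum_(i < #|T|) F (enum_val i) = \sum_x F x.
Proof. by rewrite [RHS](reindex _ (onW_bij _ (@enum_val_bij T))). Qed.

Lemma laplacian_mxE i j : laplacian_mx R e i j =
  (degree e (enum_val i))%:R *+ (i == j) - (e (enum_val i) (enum_val j))%:R.
Proof. by rewrite !mxE. Qed.

Lemma laplacian_degree0 i j :
  degree e (enum_val i) = 0%N -> laplacian_mx R e i j = 0.
Proof.
move=> d0; rewrite laplacian_mxE d0 mul0rn.
move/eqP: d0; rewrite degree_eq0 inE => /forallP/(_ (enum_val j))/negPf->.
by rewrite subrr.
Qed.

Lemma laplacian_sym : (laplacian_mx R e)^T = laplacian_mx R e.
Proof.
apply/matrixP => i j; rewrite mxE !laplacian_mxE [e _ _]e_sym eq_sym.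
by case: eqVneq => [->|].
Qed.

Lemma row_mul_laplacian (u : 'rV[R]_#|T|) j :
  (u *m laplacian_mx R e) 0 j =
  \sum_i (e (enum_val i) (enum_val j))%:R * (u 0 j - u 0 i).
Proof.
rewrite mxE; under eq_bigr do rewrite laplacian_mxE mulrBr mulrnAr.
rewrite big_split /= sumrN.
rewrite [X in X - _](bigD1 j) //= eqxx big1 => [|i /negPf->]; last by rewrite mulr0n.
under [RHS]eq_bigr do rewrite mulrBr; rewrite [RHS]big_split /= sumrN addr0.
congr (_ - _); last by apply: eq_bigr => i _; rewrite mulrC.
rewrite -mulr_suml mulrC degree_sum -sum_enum_val.
by congr (_ * _); apply: eq_bigr => i _; rewrite e_sym.
Qed.

(** Each edge is seen from both ends: exchanging the two summation indices and
    averaging turns the bilinear expression into a sum of squares. *)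
Lemma dirichlet_form (u : 'rV[R]_#|T|) :
  (\sum_j (u *m laplacian_mx R e) 0 j * u 0 j) *+ 2 =
  \sum_j \sum_i (e (enum_val i) (enum_val j))%:R * (u 0 j - u 0 i) ^+ 2.
Proof.
under eq_bigr do rewrite row_mul_laplacian mulr_suml.
rewrite mulr2n {2}exchange_big -big_split; apply: eq_bigr => j _ /=.
rewrite -big_split; apply: eq_bigr => i _ /=; rewrite [e (enum_val j) _]e_sym.
by rewrite -!mulrA -mulrDr -[u 0 i - _]opprB mulNr -mulrBr expr2.
Qed.

Lemma laplacian_kernel_constant (u : 'rV[R]_#|T|) i j :
  u *m laplacian_mx R e = 0 -> connect e (enum_val i) (enum_val j) -> u 0 i = u 0 j.
Proof.
move=> uL0; pose f x := u 0 (enum_rank x).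
have fE k : f (enum_val k) = u 0 k by rewrite /f enum_valK.
have u_edge x y : e x y -> f x = f y.
  have term_ge0 k l : 0 <= (e (enum_val l) (enum_val k))%:R * (u 0 k - u 0 l) ^+ 2 :> R.
    by rewrite mulr_ge0 ?ler0n ?sqr_ge0.
  have := dirichlet_form u; rewrite uL0.
  under eq_bigr do rewrite mxE mul0r.
  rewrite big1_eq mul0rn => /esym/eqP; rewrite psumr_eq0; last first.
    by move=> k _; rewrite sumr_ge0.
  move=> /allP/(_ (enum_rank x) (mem_index_enum _)) /=.
  rewrite psumr_eq0 // => /allP/(_ (enum_rank y) (mem_index_enum _)) /=.
  rewrite !enum_rankK e_sym => /[swap]->; rewrite mul1r sqrf_eq0 subr_eq0.
  by move/eqP.
rewrite -!fE; case/connectP => p; elim: p (enum_val i) => [|y p IHp] x /= => [_ ->//|].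
by case/andP=> /u_edge -> /IHp.
Qed.

(** The indicators of the components, indexed by the component representatives,
    form a basis of the kernel. *)
Lemma rank_laplacian : \rank (laplacian_mx R e) = (#|T| - n_comp e T)%N.
Proof.
pose r := [pred x | fingraph.roots e x].
have conn_sym : connect_sym e := sym_connect_sym e_sym.
pose B : 'M[R]_(#|r|, #|T|) :=
  \matrix_(k, i) (enum_val k == fingraph.root e (enum_val i))%:R.
have Bfree : \rank B = #|r|.
  (* Evaluation at the representatives is a right inverse of B. *)
  pose C : 'M[R]_(#|T|, #|r|) := \matrix_(i, k) (enum_val i == enum_val k)%:R.
  apply/eqP; apply/row_freeP; exists C.
  apply/matrixP => k l; rewrite !mxE.
  under eq_bigr do rewrite !mxE.
  rewrite (sum_enum_val (fun x =>
    (enum_val k == fingraph.root e x)%:R * (x == enum_val l)%:R)).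
  rewrite (bigD1 (enum_val l)) //= eqxx mulr1 big1 ?addr0; last first.
    by move=> x /negPf->; rewrite mulr0.
  have /eqP-> : fingraph.roots e (enum_val l) by have := enum_valP l.
  by rewrite (inj_eq enum_val_inj).
have n_compE : n_comp e T = #|r| by apply: eq_card => x; rewrite !inE andbT.
suff kerB : (kermx (laplacian_mx R e) :=: B)%MS.
  have := mxrank_ker (laplacian_mx R e); rewrite kerB Bfree n_compE => ->.
  by rewrite subKn ?rank_leq_row.
apply/eqmxP/andP; split; last first.
  apply/sub_kermxP/row_matrixP => k; rewrite row_mul row0; apply/rowP => j.
  rewrite row_mul_laplacian [RHS]mxE big1 // => i _; rewrite !mxE.
  case: (boolP (e _ _)) => [eij|]; last by rewrite mul0r.
  by rewrite (fingraph.rootP conn_sym (connect1 eij)) subrr mulr0.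
apply/rV_subP => u /sub_kermxP uL0.
suff -> : u = (\row_k u 0 (enum_rank (enum_val k))) *m B by exact: submxMl.
apply/rowP => i; rewrite mxE.
have ri : fingraph.root e (enum_val i) \in r by rewrite inE fingraph.roots_root.
rewrite (bigD1 (enum_rank_in ri (fingraph.root e (enum_val i)))) //= big1 => [|k kNi].
  rewrite !mxE !enum_rankK_in // eqxx mulr1 addr0.
  by apply: laplacian_kernel_constant => //; rewrite enum_rankK connect_root.
rewrite !mxE; case: eqP => [kE|_]; last by rewrite mulr0.
by case/eqP: kNi; apply: enum_val_inj; rewrite kE enum_rankK_in.
Qed.

Local Notation q x := ((Num.sqrt (degree e x)%:R)^-1 : R).

Lemma normalized_laplacian_mxE i j : normalized_laplacian_mx R e i j =
  q (enum_val i) * laplacian_mx R e i j * q (enum_val j).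
Proof. by rewrite /normalized_laplacian_mx mul_mx_diag mxE mul_diag_mx !mxE. Qed.

Lemma normalized_laplacian_sym :
  (normalized_laplacian_mx R e)^T = normalized_laplacian_mx R e.
Proof.
apply/matrixP => i j; rewrite mxE !normalized_laplacian_mxE.
by rewrite -[in LHS]laplacian_sym mxE mulrC mulrA mulrAC.
Qed.

(** At an isolated vertex the entry 0 of [D^(-1/2)] may be replaced by 1, since
    the corresponding row and column of the Laplacian vanish; the two outer
    factors then become invertible. *)
Lemma rank_normalized_laplacian :
  \rank (normalized_laplacian_mx R e) = (#|T| - n_comp e T)%N.
Proof.
rewrite -rank_laplacian.
pose w : 'rV[R]_#|T| := \row_i (if degree e (enum_val i) == 0%N then 1 else q (enum_val i)).
have Wunit : diag_mx w \in unitmx.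
  rewrite unitmxE det_diag unitfE; apply/prodf_neq0 => i _; rewrite mxE.
  case: (eqVneq (degree e _) 0%N) => [_|d0] /=; first exact: oner_neq0.
  by rewrite invr_eq0 sqrtr_eq0 -ltNge ltr0n lt0n.
have -> : normalized_laplacian_mx R e = diag_mx w *m laplacian_mx R e *m diag_mx w.
  apply/matrixP => i j.
  rewrite normalized_laplacian_mxE mul_mx_diag mul_diag_mx [RHS]mxE.
  rewrite [X in _ = X * _]mxE [w 0 i]mxE [w 0 j]mxE.
  case: eqP => [d0|_]; first by rewrite (laplacian_degree0 j d0) !(mulr0, mul0r).
  case: eqP => [d0|_] //.
  by rewrite -laplacian_sym mxE (laplacian_degree0 i d0) !(mulr0, mul0r).
rewrite mxrankMfree ?row_free_unit // -mxrank_tr trmx_mul.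
by rewrite mxrankMfree ?mxrank_tr // row_free_unit unitmx_tr.
Qed.

Lemma sqr_invsqrt_degree x : q x * q x = (degree e x)%:R^-1.
Proof. by rewrite -expr2 exprVn sqr_sqrtr ?ler0n. Qed.

Lemma trace_normalized_laplacian :
  \tr (normalized_laplacian_mx R e) = #|T|%:R - #|isolated_vertices e|%:R.
Proof.
pose f x : R := (x \notin isolated_vertices e)%:R.
rewrite /mxtrace (eq_bigr (f \o enum_val)) /= => [|i _]; last first.
  rewrite normalized_laplacian_mxE laplacian_mxE eqxx e_irr subr0 mulr1n /f -degree_eq0.
  case: eqP => [->|/eqP]; first by rewrite mulr0 mul0r.
  by rewrite -lt0n => d0; rewrite mulrAC sqr_invsqrt_degree mulVf // pnatr_eq0 -lt0n.
rewrite sum_enum_val -natr_sum -natrB ?max_card //; congr _%:R.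
rewrite -(cardC (mem (isolated_vertices e))) addKn -sum1_card [RHS]big_mkcond /=.
by apply: eq_bigr => x _; rewrite !inE; case: [forall y, ~~ e x y].
Qed.

End GraphMatrices.

(** * The lower bound *)

Lemma expR_tangent (R : realType) (mu x : R) :
  expR mu * (1 + (x - mu)) <= expR x ?= iff (x == mu).
Proof.
have xE : expR x = expR mu * expR (x - mu) by rewrite -expRD addrC subrK.
apply/leifP; case: eqVneq => [->|x_neq]; first by rewrite subrr addr0 mulr1.
by rewrite xE ltr_pM2l ?expR_gt0 // expR_gt1Dx // subr_eq0.
Qed.

(** Sum the tangent inequalities at the mean value [mu]: the linear terms cancel.
    Defining [mu] by the equation allows an empty [P]. *)
Lemma expR_jensen (R : realType) (I : finType) (P : pred I) (f : I -> R) (mu : R) :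
  \sum_(i | P i) f i = #|P|%:R * mu ->
  #|P|%:R * expR mu <= \sum_(i | P i) expR (f i)
    ?= iff [forall (i | P i), f i == mu].
Proof.
move=> sum_f; have := leif_sum (fun i (_ : P i) => expR_tangent mu (f i)).
rewrite -mulr_sumr big_split /= sumrB sum_f !sumr_const /=.
by rewrite -[mu *+ _]mulr_natl subrr addr0 mulrC.
Qed.

Section NEEBound.
Variables (R : realType) (T : finType) (e : rel T).
Hypotheses (e_sym : symmetric e) (e_irr : irreflexive e).
Local Notation L := (normalized_laplacian_mx R e).
Local Notation N := (#|T|%:R : R).
Local Notation c := ((n_comp e T)%:R : R).
Local Notation r := (#|isolated_vertices e|%:R : R).

(** The zero eigenvalues contribute [c * expR (-1)]; Jensen's inequality is
    applied to the others, whose number and sum are the rank and the trace. *)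
Lemma NEE_bound :
  let bound := (N - c) * expR ((c - r) / (N - c)) + c * expR (-1) in
  bound <= NEE R e /\ (NEE R e = bound <-> exists l, L *m L = l *: L).
Proof.
have [P [d [Punit PA]]] := symmetric_diagonalizable (normalized_laplacian_sym R e_sym).
set mu := (c - r) / (N - c).
pose nz := [pred i | d 0 i != 0].
have c_le : (n_comp e T <= #|T|)%N by apply: max_card.
have card_nz : #|nz| = (#|T| - n_comp e T)%N.
  rewrite -(rank_normalized_laplacian R e_sym) (rank_diagonalized Punit PA).
  by rewrite -sum1_card big_mkcond; apply: eq_bigr => i _ /=; rewrite inE; case: (_ != _).
have card_nzR : #|nz|%:R = N - c by rewrite card_nz natrB.
have sum_nz : \sum_(i | nz i) (d 0 i - 1) = #|nz|%:R * mu.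
  (* Without nonzero eigenvalue, mu is a quotient by 0 and both sides are 0. *)
  have [nz0|nz0] := posnP #|nz|.
    by rewrite nz0 mul0r big_pred0 // => i; apply: (card0_eq nz0).
  rewrite /mu -card_nzR mulrC divfK ?pnatr_eq0 -?lt0n // sumrB sumr_const card_nzR.
  have -> : \sum_(i | nz i) d 0 i = \tr L.
    rewrite (mxtrace_diagonalized Punit PA) [RHS](bigID nz) /= [X in _ + X]big1 ?addr0 //.
    by move=> i; rewrite negbK => /eqP.
  by rewrite trace_normalized_laplacian //; ring.
have NEE_E : NEE R e = \sum_(i | nz i) expR (d 0 i - 1) + c * expR (-1).
  rewrite /NEE (perm_big _ (spectrum_diagonalized Punit PA)) big_image /= (bigID nz) /=.
  congr (_ + _); rewrite (eq_bigr (fun=> expR (-1))) => [|i]; last first.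
    by rewrite negbK => /eqP->; rewrite sub0r.
  rewrite sumr_const -[LHS]mulr_natl; congr (_%:R * _).
  have := cardC nz; rewrite card_nz card_ord => /eqP.
  by rewrite -[X in _ == X](subnK c_le) eqn_add2l => /eqP.
have := expR_jensen sum_nz; rewrite card_nzR => -[jensen_le jensen_eq].
split=> //; first by rewrite NEE_E lerD2r.
rewrite NEE_E; split=> [/addIr/eqP|[l /(sqr_diagonalized Punit PA) dl]].
  rewrite eq_sym jensen_eq => /forall_inP d_mu; exists (mu + 1).
  apply/(sqr_diagonalized Punit PA) => i di.
  by have /eqP <- := d_mu i di; rewrite subrK.
congr (_ + _); apply/esym/eqP; rewrite jensen_eq; apply/forall_inP => i di.
have nz_gt0 : #|nz|%:R != 0 :> R.
  by rewrite pnatr_eq0 -lt0n; apply/card_gt0P; exists i.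
apply/eqP/(mulfI nz_gt0); rewrite -sum_nz (dl i) // mulr_natl -sumr_const.
by apply: eq_bigr => j dj; rewrite (dl j).
Qed.

End NEEBound.

(** * The equality case *)

(** This says that the components are isolated vertices and copies of [K_s]; it
    is phrased through adjacency and degrees because matrix entries see these
    and not the components. *)
Definition equal_cliques (T : finType) (e : rel T) (s : nat) : Prop :=
  (forall x y z, e x y -> e y z -> x != z -> e x z) /\
  (forall x y, e x y -> (degree e x).+1 = s).

Section EqualCliques.
Variables (R : realType) (T : finType) (e : rel T).
Hypotheses (e_sym : symmetric e) (e_irr : irreflexive e).
Local Notation L := (normalized_laplacian_mx R e).
Local Notation q x := ((Num.sqrt (degree e x)%:R)^-1 : R).

Lemma invsqrt_degree_gt0 x y : e x y -> 0 < q x.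
Proof. by move=> /degree_gt0; rewrite invr_gt0 sqrtr_gt0 ltr0n. Qed.

(** Adjacent vertices have the same closed neighbourhood. *)
Lemma degree_clique :
  (forall x y z, e x y -> e y z -> x != z -> e x z) ->
  forall x y, e x y -> degree e x = degree e y.
Proof.
move=> e_clique.
have le x y : e x y -> (degree e x <= degree e y)%N.
  move=> exy; have exx : x \notin [set z | e x z] by rewrite inE e_irr.
  have eyy : y \notin [set z | e y z] by rewrite inE e_irr.
  rewrite -ltnS -[_.+1]add1n -[X in (_ <= X)%N]add1n.
  have := subset_leq_card (A := x |: [set z | e x z]) (B := y |: [set z | e y z]).
  rewrite !cardsU1 exx eyy; apply.
  apply/subsetP => z; rewrite !inE => /orP[/eqP->|exz]; first by rewrite e_sym exy orbT.
  case: eqVneq => //= z_neq; apply: (e_clique _ x) => //; first by rewrite e_sym.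
  by rewrite eq_sym.
by move=> x y exy; apply/eqP; rewrite eqn_leq !le // e_sym.
Qed.

(** All non-isolated degrees are [s - 1], so [L] is the Laplacian divided by
    [s - 1]; and the Laplacian of [K_s] is [s] times a projection. *)
Lemma equal_cliques_sqr s : equal_cliques e s -> exists l, L *m L = l *: L.
Proof.
move=> [e_clique e_deg]; pose t : R := s.-1%:R^-1.
have degE x : degree e x <> 0%N -> degree e x = s.-1.
  by move=> /eqP; rewrite -lt0n => /card_gt0P[y]; rewrite inE => /e_deg <-.
have LE : L = t *: laplacian_mx R e.
  apply/matrixP => i j; rewrite normalized_laplacian_mxE [RHS]mxE.
  case: (degree e (enum_val i) =P 0%N) => [d0|/degE di].
    by rewrite (laplacian_degree0 R j d0) !(mulr0, mul0r).
  case: (degree e (enum_val j) =P 0%N) => [d0|/degE dj].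
    by rewrite -(laplacian_sym R e_sym) mxE (laplacian_degree0 R i d0) !(mulr0, mul0r).
  by rewrite dj -di mulrAC sqr_invsqrt_degree di.
exists (t * s%:R); rewrite LE -scalemxAl -scalemxAr scalerA.
suff -> : laplacian_mx R e *m laplacian_mx R e = s%:R *: laplacian_mx R e.
  by rewrite !scalerA mulrAC.
(* The (x, y) entry sums lap y - lap z over the neighbours z of y, where lap is
   the row of x; it is computed for y equal, nonadjacent and adjacent to x. *)
apply/matrixP => i j; rewrite [RHS]mxE.
have := row_mul_laplacian e_sym (row i (laplacian_mx R e)) j.
rewrite -row_mul mxE => ->; under eq_bigr do rewrite ![row _ _ _ _]mxE.
set x := enum_val i; set y := enum_val j.
pose lap z : R := (degree e x)%:R *+ (x == z) - (e x z)%:R.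
have lapE k : laplacian_mx R e i k = lap (enum_val k).
  by rewrite laplacian_mxE /lap /x (inj_eq enum_val_inj).
under eq_bigr do rewrite !lapE; rewrite lapE -/y.
rewrite (sum_enum_val (fun z => (e z y)%:R * (lap y - lap z))).
have [xy|xy] := eqVneq x y.
  rewrite -xy (eq_bigr (fun z => (e x z)%:R * s%:R)) => [|z _].
    rewrite -mulr_suml -degree_sum mulrC; congr (_ * _).
    by rewrite /lap eqxx e_irr subr0.
  rewrite e_sym; case: (boolP (e x z)) => [exz|]; last by rewrite !mul0r.
  rewrite !mul1r /lap eqxx e_irr exz; case: eqVneq => [xz|_].
    by rewrite -xz e_irr in exz.
  by rewrite mulr1n mulr0n subr0 sub0r opprK natr1 (e_deg _ _ exz).
have [exy|nexy] := boolP (e x y); last first.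
  rewrite [lap y]/lap (negPf xy) (negPf nexy) mulr0n subrr mulr0 big1 // => z _.
  case: (boolP (e z y)) => [ezy|]; last by rewrite mul0r.
  rewrite mul1r sub0r /lap; case: eqVneq => [xz|xz].
    by rewrite xz ezy in nexy.
  case: (boolP (e x z)) => [exz|_]; last by rewrite mulr0n subrr oppr0.
  by rewrite (e_clique x z y) in nexy.
have lapy : lap y = -1 by rewrite /lap (negPf xy) exy mulr0n sub0r.
rewrite (bigD1 x) //= exy lapy big1 => [|z zx].
  rewrite /lap eqxx e_irr mulr1n subr0 addr0 mul1r mulrN1.
  by rewrite -opprD addrC natr1 (e_deg _ _ exy).
case: (boolP (e z y)) => [ezy|]; last by rewrite mul0r.
have exz : e x z by apply: (e_clique x y) => //; rewrite 1?e_sym 1?eq_sym.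
by rewrite /lap [x == z]eq_sym (negPf zx) exz mulr0n sub0r opprK addNr mulr0.
Qed.

(** Entries [(x, z)] at distance 2 force cliques, diagonal entries force equal
    degrees. *)
Lemma sqr_equal_cliques l : L *m L = l *: L -> exists2 s, (2 <= s)%N & equal_cliques e s.
Proof.
move=> L2; pose nl x y : R := q x * ((degree e x)%:R *+ (x == y) - (e x y)%:R) * q y.
have nlE i j : L i j = nl (enum_val i) (enum_val j).
  by rewrite normalized_laplacian_mxE laplacian_mxE /nl (inj_eq enum_val_inj).
have nl2 x y : \sum_z nl x z * nl z y = l * nl x y.
  move/matrixP/(_ (enum_rank x) (enum_rank y)): L2.
  rewrite mxE [RHS]mxE; under eq_bigr do rewrite !nlE.
  by rewrite nlE !enum_rankK (sum_enum_val (fun z => nl x z * nl z y)).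
have nl_neq x y : x != y -> nl x y = - (q x * q y * (e x y)%:R).
  by move=> /negPf xy; rewrite /nl xy mulr0n sub0r mulrN mulNr mulrAC.
have q_ge0 x : 0 <= q x by rewrite invr_ge0 sqrtr_ge0.
have e_clique x y z : e x y -> e y z -> x != z -> e x z.
  move=> exy eyz xz; apply/negPn/negP => nexz.
  have nlxz : nl x z = 0 by rewrite nl_neq // (negPf nexz) mulr0 oppr0.
  have := nl2 x z; rewrite nlxz mulr0 => /eqP; rewrite psumr_eq0; last first.
    move=> w _; have [->|wx] := eqVneq w x; first by rewrite nlxz mulr0.
    have [->|wz] := eqVneq w z; first by rewrite nlxz mul0r.
    by rewrite nl_neq 1?eq_sym // nl_neq // mulrNN !mulr_ge0 ?ler0n.
  move=> /allP/(_ y (mem_index_enum _)) /=.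
  rewrite nl_neq; last by apply: contraTneq exy => ->; rewrite e_irr.
  rewrite nl_neq; last by apply: contraTneq eyz => ->; rewrite e_irr.
  rewrite exy eyz mulrNN !mulr1 gt_eqF // !mulr_gt0 //.
  - exact: invsqrt_degree_gt0 exy.
  - exact: invsqrt_degree_gt0 eyz.
  - exact: invsqrt_degree_gt0 eyz.
  - by rewrite (@invsqrt_degree_gt0 z y) // e_sym.
have e_degree := degree_clique e_clique.
have degl x y : e x y -> l = 1 + (degree e x)%:R^-1.
  move=> exy; have d_gt0 := degree_gt0 exy.
  have d_neq0 : (degree e x)%:R != 0 :> R by rewrite pnatr_eq0 -lt0n.
  have nlxx : nl x x = 1.
    by rewrite /nl eqxx e_irr subr0 mulr1n mulrAC sqr_invsqrt_degree mulVf.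
  have := nl2 x x; rewrite nlxx mulr1 => <-.
  rewrite (bigD1 x) //= nlxx mulr1; congr (_ + _).
  rewrite (eq_bigr (fun z => (e x z)%:R * (degree e x)%:R^-1 ^+ 2)) => [|z zx].
    rewrite -mulr_suml; have -> : \sum_(z | z != x) (e x z)%:R = (degree e x)%:R :> R.
      by rewrite degree_sum [RHS](bigD1 x) //= e_irr add0r.
    by rewrite expr2 mulrA mulfV // mul1r.
  rewrite !nl_neq // 1?eq_sym // [e z x]e_sym mulrNN.
  case: (boolP (e x z)) => [exz|_]; last by rewrite !(mulr0, mul0r).
  by rewrite -(e_degree _ _ exz) !mulr1 mul1r sqr_invsqrt_degree.
(* In an edgeless graph any s fits. *)
case: (pickP (fun p : T * T => e p.1 p.2)) => [[x y] /= exy|noedge]; last first.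
  by exists 2 => //; split=> // x y exy; have := noedge (x, y); rewrite /= exy.
exists (degree e x).+1; first by rewrite ltnS (degree_gt0 exy).
split=> // x' y' exy'; congr _.+1; apply/eqP; rewrite -(eqr_nat R).
by apply/eqP/invr_inj/(addrI 1); rewrite -(degl _ _ exy) -(degl _ _ exy').
Qed.

End EqualCliques.

(** * Unions of equal cliques up to isomorphism *)

Section Isomorphism.
Variables (T : finType) (e : rel T) (s : nat).
Hypotheses (e_sym : symmetric e) (e_irr : irreflexive e).
Local Notation iso := (isolated_vertices e).

Lemma iso_equal_cliques k r :
  graph_isomorphic e
    (disjoint_union (copies (k := k) (@complete_graph s)) (@empty_graph r)) ->
  equal_cliques e s.
Proof.
case=> f f_bij f_mono; split=> [x y z|x y].
  rewrite -!f_mono -(bij_eq f_bij).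
  case: (f x) (f y) (f z) => [[a i]|i] [[b j]|j] [[c l]|l] //=.
  rewrite /copies /complete_graph /= => /andP[/eqP-> _] /andP[/eqP-> _].
  by apply: contraNT; rewrite eqxx negbK => /eqP->.
rewrite -f_mono => fxy.
case fxE: (f x) fxy => [[a i]|i]; last by case: (f y).
move=> _; pose nbhd : {set 'I_k * 'I_s + 'I_r} := [set inl (a, j) | j in [set~ i]].
have -> : degree e x = #|nbhd|.
  rewrite /degree -(on_card_preimset (onW_bij _ f_bij)); apply: eq_card => z.
  rewrite !inE -f_mono fxE; case: (f z) => [[b j]|j]; last first.
    by apply/esym/negbTE/negP => /imsetP[].
  rewrite /disjoint_union /copies /complete_graph /=.
  apply/andP/imsetP => [[/eqP-> ij]|[l /[!inE] li [-> ->]]].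
    by exists j => //; rewrite !inE eq_sym.
  by rewrite eqxx eq_sym.
rewrite card_imset => [|j j' []//]; rewrite cardsC1 card_ord prednK //.
exact: leq_ltn_trans (leq0n i) (ltn_ord i).
Qed.

(** A non-isolated vertex is sent to the rank of its component among the
    nontrivial components and its rank inside the component.  This map is
    injective and respects adjacency; it is onto because [T] has as many vertices
    as the target, its nontrivial components having [s] vertices each. *)
Lemma equal_cliques_iso : equal_cliques e s ->
  graph_isomorphic e
    (disjoint_union (copies (k := (n_comp e T - #|iso|)%N) (@complete_graph s))
                    (@empty_graph #|iso|)).
Proof.
move=> [e_clique e_deg].
have conn_sym : connect_sym e := sym_connect_sym e_sym.
have connE x y : connect e x y = (x == y) || e x y.
  apply/idP/orP => [/connectP[p]|[/eqP->|/connect1]//].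
  elim: p x => [|z p IHp] x /= => [_ ->|/andP[exz zp] ylast]; first by left.
  have [/eqP zy|ezy] := IHp z zp ylast; first by right; rewrite -zy.
  by have [|xy] := eqVneq x y; [left|right; apply: e_clique ezy xy].
have isoP x : reflect (forall y, ~~ e x y) (x \in iso) by rewrite inE; apply: forallP.
have root_iso x : (fingraph.root e x \in iso) = (x \in iso).
  have := connect_root e x; rewrite connE; case: eqVneq => [<-//|_ /=] exr.
  apply/isoP/isoP => [/(_ x)|/(_ (fingraph.root e x))]; last by rewrite exr.
  by rewrite e_sym exr.
pose P := [set x | fingraph.roots e x & x \notin iso].
have card_P : #|P| = (n_comp e T - #|iso|)%N.
  have -> : P = [set x | fingraph.roots e x] :\: iso.
    by apply/setP => x; rewrite in_setD !in_set andbC.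
  have -> : n_comp e T = #|[set x | fingraph.roots e x]|.
    by rewrite cardsE; apply: eq_card => x; rewrite !inE andbT.
  rewrite cardsD (setIidPr _) //; apply/subsetP => x /isoP x_iso; rewrite inE.
  by have := connect_root e x; rewrite connE (negPf (x_iso _)) orbF eq_sym.
pose cls x := enum (connect e (fingraph.root e x)).
have mem_cls x : x \in cls x by rewrite mem_enum -topredE /= conn_sym; apply: connect_root.
have size_cls x : x \notin iso -> size (cls x) = s.
  rewrite -root_iso -cardE; move: (fingraph.root e x) => y yNi.
  have [z eyz] : exists z, e y z.
    by apply/existsP; move: yNi; rewrite inE negb_forall; under eq_existsb do rewrite negbK.
  rewrite -(e_deg _ _ eyz) -[RHS]add1n.
  have <- : y \notin [set z | e y z] = 1%N :> nat by rewrite inE e_irr.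
  rewrite -cardsU1; apply: eq_card => w.
  by rewrite !inE [LHS]connE eq_sym.
pose code (x : T) (u : 'I_(n_comp e T - #|iso|) * 'I_s + 'I_#|iso|) : bool :=
  match u with
  | inl (a, b) => [&& x \notin iso, a == index (fingraph.root e x) (enum P) :> nat
                    & b == index x (cls x) :> nat]
  | inr a => (x \in iso) && (a == index x (enum iso) :> nat)
  end.
have [f fP] : exists f : T -> _, forall x, code x (f x).
  apply: (fin_all_exists (P := fun x u => code x u)) => x; have [xi|xNi] := boolP (x \in iso).
    have lt : (index x (enum iso) < #|iso|)%N by rewrite cardE index_mem mem_enum.
    by exists (inr (Ordinal lt)); rewrite /code xi /=.
  have ltP : (index (fingraph.root e x) (enum P) < n_comp e T - #|iso|)%N.
    by rewrite -card_P cardE index_mem mem_enum inE fingraph.roots_root // root_iso.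
  have lts : (index x (cls x) < s)%N by rewrite -(size_cls x xNi) index_mem.
  by exists (inl (Ordinal ltP, Ordinal lts)); rewrite /code xNi /= !eqxx.
have same_root x y : x \notin iso -> y \notin iso ->
    index (fingraph.root e x) (enum P) = index (fingraph.root e y) (enum P) ->
    fingraph.root e x = fingraph.root e y.
  move=> xNi yNi; apply: (index_inj x (s := enum P));
    by rewrite mem_enum inE fingraph.roots_root // root_iso.
have f_inj : injective f.
  move=> x y fxy; have := fP y; have := fP x; rewrite -fxy.
  case: (f x) => [[a b]|a] /=.
    case/and3P=> xNi /eqP-> /eqP-> /and3P[yNi /eqP /same_root-/(_ xNi yNi) rxy].
    have := mem_cls x; have := mem_cls y; rewrite /cls rxy => yc xc /eqP.
    exact: (index_inj x (s := enum (connect e (fingraph.root e y)))).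
  case/andP=> xi /eqP-> /andP[yi /eqP].
  by apply: (index_inj x (s := enum iso)); rewrite mem_enum.
have f_mono : {mono f : x y / e x y >->
    disjoint_union (copies (k := (n_comp e T - #|iso|)%N) (@complete_graph s))
                   (@empty_graph #|iso|) x y}.
  move=> x y; have := fP y; have := fP x; have := inj_eq f_inj x y.
  case: (f x) (f y) => [[a b]|a] [[a' b']|a'] /=.
  - move=> fxy /and3P[xNi /eqP aE /eqP bE] /and3P[yNi /eqP aE' /eqP bE'].
    rewrite /copies /complete_graph /=.
    have aa' : (a == a') = connect e x y.
      rewrite -(fingraph.root_connect conn_sym) -val_eqE /= aE aE'.
      by apply/eqP/eqP => [/same_root|->//]; apply.
    rewrite aa' connE; have [xy|xy] /= := eqVneq x y.
      by move: fxy; rewrite xy e_irr eqxx => /eqP[_ ->]; rewrite eqxx.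
    case: (boolP (e x y)) => //= exy; apply: contraNneq xy => bb'; rewrite -fxy bb'.
    have /eqP-> : a == a' by rewrite aa' connect1.
    by rewrite eqxx.
  - by move=> _ _ /andP[/isoP yi _]; rewrite e_sym (negPf (yi x)).
  - by move=> _ /andP[/isoP xi _] _; rewrite (negPf (xi y)).
  - by move=> _ /andP[/isoP xi _] _; rewrite (negPf (xi y)).
exists f => //; apply: inj_card_bij => //.
rewrite card_sum card_prod !card_ord -card_P -(cardsC iso) addnC leq_add2l.
rewrite -[X in (_ <= X)%N]sum1_card (partition_big (fingraph.root e) (mem P)) /=; last first.
  by move=> x; rewrite in_setC [_ \in P]in_set fingraph.roots_root // root_iso.
rewrite -sum_nat_const leq_eqVlt; apply/orP; left; apply/eqP; apply: eq_bigr => p.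
rewrite inE => /andP[/eqP rp pNi]; rewrite -(size_cls p pNi) /cls rp -cardE -sum1_card.
apply: eq_bigl => x; rewrite in_setC -[LHS]/(connect e p x).
rewrite -(fingraph.root_connect conn_sym) rp eq_sym andbC.
by case: eqP => //= px; rewrite -root_iso px.
Qed.
End Isomorphism.

Theorem theorem3 (R : realType) (T : finType) (e : rel T)
    (e_sym : symmetric e) (e_irr : irreflexive e)
    (N c r : nat) (N_gt0 : (0 < N)%N) (card_T : #|T| = N)
    (comp_c : n_comp e T = c) (isolated_r : #|isolated_vertices e| = r) :
  let bound : R :=
    (N%:R - c%:R) * expR ((c%:R - r%:R) / (N%:R - c%:R)) + c%:R * expR (-1) in
  bound <= NEE R e /\
  (NEE R e = bound <->
   exists2 s : nat, (2 <= s)%N &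
     graph_isomorphic e
       (disjoint_union (copies (k := (c - r)%N) (@complete_graph s))
                       (@empty_graph r))).
Proof.
rewrite -card_T -comp_c -isolated_r => bound; rewrite {}/bound.
have [bound_le bound_eq] := NEE_bound R e_sym e_irr.
split; first exact: bound_le.
apply: (iff_trans bound_eq); split=> [[l L2]|[s _ e_iso]].
  have [s s_ge2 e_cliques] := sqr_equal_cliques e_sym e_irr L2.
  by exists s => //; apply: equal_cliques_iso.
by apply: (equal_cliques_sqr R e_sym e_irr (s := s)); apply: iso_equal_cliques e_iso.
Qed.
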